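(* The generating function for $\{213,321\}$-avoiding perfect matchings is $$\sum_{n\ge0}|\mathcal{M}_n(213,321)|z^{2n}=G(0,0,z),$$ where $G(t,u,z)$, a formal power series in $z$ with coefficients polynomials in $t$ and $u$, is the solution of the functional equation $$G(t,u,z)=1+z\Bigg(tG(t,u,z)+\frac{G(t,u,z)-G(t,0,z)}{tu}+\frac{G(t,0,z)-G(0,0,z)}{t}+\frac{tu}{1-u}\bigl(G(t,0,z)-G(tu,0,z)\bigr)\Bigg).$$
   Context: A perfect matching of $[2n]$ is a set of $n$ disjoint pairs $(i,j)$, $i<j$, covering $[2n]$. It avoids $\tau\in S_k$ if there are no $i_1<\dots<i_{2k}$ such that all pairs $(i_a,i_{2k+1-\tau(a)})$, $1\le a\le k$, belong to it. $\mathcal{M}_n(213,321)$ is the set of perfect matchings of $[2n]$ avoiding both $213$ and $321$. *)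

(* Defs.v *)
From mathcomp Require Import all_boot all_order all_algebra perm.
From mathcomp Require Import mpoly.

Set Implicit Arguments.
Unset Strict Implicit.
Unset Printing Implicit Defensive.

Import GRing.Theory.
Local Open Scope ring_scope.

(* The ground set [2n] is 'I_(2 * n), numbered from 0; a pair (i, j) with i < j
   is an element of 'I_(2 * n) * 'I_(2 * n). *)
Section Matchings.

Variable n : nat.
Local Notation arc := ('I_(2 * n) * 'I_(2 * n))%type.

Definition ends (p : arc) : {set 'I_(2 * n)} := [set p.1; p.2].

Definition perfect_matching (M : {set arc}) : bool :=
  [&& #|M| == n,
      [forall p in M, (p.1 < p.2)%N],
      [forall p in M, forall q in M, (p != q) ==> [disjoint ends p & ends q]]
    & \bigcup_(p in M) ends p == [set: 'I_(2 * n)]].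

(* With 0-based positions and values, the index 2k+1-tau(a) is
   2k - 1 - tau a, that is, rev_ord of the position tau a in 'I_(k + k). *)
Definition contains (k : nat) (tau : 'S_k) (M : {set arc}) : bool :=
  [exists i : {ffun 'I_(k + k) -> 'I_(2 * n)},
     [forall x : 'I_(k + k), forall y : 'I_(k + k), (x < y)%N ==> (i x < i y)%N] &&
     [forall a : 'I_k,
        (i (lshift k a), i (rev_ord (lshift k (tau a)))) \in M]].

Definition avoids (k : nat) (tau : 'S_k) (M : {set arc}) : bool :=
  ~~ contains tau M.

End Matchings.

Definition pat213 : 'S_3 := tperm (@Ordinal 3 0 isT) (@Ordinal 3 1 isT).
Definition pat321 : 'S_3 := tperm (@Ordinal 3 0 isT) (@Ordinal 3 2 isT).

Lemma pat213_oneline :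
  [seq (val (pat213 i)).+1 | i <- enum 'I_3] = [:: 2; 1; 3]%N.
Proof.
rewrite (_ : enum 'I_3 = [:: @Ordinal 3 0 isT; @Ordinal 3 1 isT; @Ordinal 3 2 isT]).
  by rewrite /= tpermL tpermR tpermD.
by apply: (inj_map val_inj); rewrite val_enum_ord.
Qed.

Lemma pat321_oneline :
  [seq (val (pat321 i)).+1 | i <- enum 'I_3] = [:: 3; 2; 1]%N.
Proof.
rewrite (_ : enum 'I_3 = [:: @Ordinal 3 0 isT; @Ordinal 3 1 isT; @Ordinal 3 2 isT]).
  by rewrite /= tpermL tpermR tpermD.
by apply: (inj_map val_inj); rewrite val_enum_ord.
Qed.

Definition matchings_213_321 (n : nat) :
    {set {set 'I_(2 * n) * 'I_(2 * n)}} :=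
  [set M | [&& perfect_matching M, avoids pat213 M & avoids pat321 M]].

(* A formal power series in z over A is its sequence of coefficients nat -> A. *)
Section PowerSeries.

Variable A : nzRingType.

Definition ps_one : nat -> A := fun m => if m is 0 then 1 else 0.

Definition ps_mulz (f : nat -> A) : nat -> A :=
  fun m => if m is m'.+1 then f m' else 0.

(* \sum_(n >= 0) c n * z ^ (2 n) *)
Definition ps_even (c : nat -> A) : nat -> A :=
  fun m => if odd m then 0 else c m./2.

End PowerSeries.

Section FunctionalEquation.

Variable R : idomainType.

(* Polynomials in t and u, and rational functions in t and u. *)
Local Notation P := {mpoly R[2]}.
Local Notation K := {fraction {mpoly R[2]}}.

Definition varT : P := 'X_(@Ordinal 2 0 isT).
Definition varU : P := 'X_(@Ordinal 2 1 isT).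

(* G(a, b, z), as a power series with coefficients in R(t, u). *)
Definition subst_tu (G : nat -> P) (a b : P) : nat -> K :=
  fun m => tofrac (G m \mPo [tuple a; b]).

(* The divisions by tu, t and 1 - u take place in the field R(t, u). *)
Definition functional_equation (G : nat -> P) : Prop :=
  let t : K := tofrac varT in
  let u : K := tofrac varU in
  let Gtu := subst_tu G varT varU in
  let Gt0 := subst_tu G varT 0 in
  let G00 := subst_tu G 0 0 in
  let Gtu0 := subst_tu G (varT * varU) 0 in
  Gtu =1 (fun m => ps_one K m +
    ps_mulz (fun k =>
        t * Gtu k
      + (Gtu k - Gt0 k) / (t * u)
      + (Gt0 k - G00 k) / t
      + t * u / (1 - u) * (Gt0 k - Gtu0 k)) m).

End FunctionalEquation.

(* Main.v *)
Require Import Defs.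
From mathcomp Require Import all_boot all_order all_algebra perm.
From mathcomp Require Import mpoly zify ring.

Set Implicit Arguments.
Unset Strict Implicit.
Unset Printing Implicit Defensive.

(** Scan the points of a matching from left to right, keeping the queue of openers
    whose arcs are still pending, listed in the order in which they will be closed.
    A closer removes the head of the queue; an opener, being larger than everything
    in the queue, may be inserted at a position exactly when the entries before it
    and the entries after it both decrease, since an increasing pair before it
    creates 321 and an increasing pair after it creates 213. Hence the queue has at
    most one ascent: if it has none, every position is allowed, and otherwise only
    the position of the ascent. Weighting a queue of length a with its ascent at b
    (b = 0 if it has none) by t^a u^b, the four terms of the functional equation
    record insertion without creating an ascent, the two kinds of removal, and
    insertion creating an ascent; empty queues are extracted at t = u = 0. *)

Import GRing.Theory.
Local Open Scope nat_scope.

(** * The scanning process *)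

(* Arcs already closed, in closing order; pending openers, in closing order;
   position of the ascent of the latter. *)
Definition state := (seq (nat * nat) * seq nat * nat)%type.

Implicit Types (p i j b c : nat) (q r : seq nat) (A : seq (nat * nat)).

Definition insert (j p : nat) (q : seq nat) := take j q ++ p :: drop j q.

Definition slots (q : seq nat) (b : nat) :=
  if b == 0 then iota 0 (size q).+1 else [:: b].

(** An opener inserted at [j] exceeds the whole queue, so it creates an ascent at [j], or none if
    [j = 0]: its position is also the new mark. Removing the head shifts the mark by one; [b.-1]
    also covers the loss of the ascent ([b = 1]) and its absence ([b = 0]). *)
Definition successors (p : nat) (X : state) : seq state :=
  let: (A, q, b) := X in
  [seq (A, insert j p q, j) | j <- slots q b] ++
  (if q is x :: q' then [:: (rcons A (x, p), q', b.-1)] else [::]).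

Fixpoint states (p : nat) : seq state :=
  if p is p'.+1 then flatten [seq successors p' X | X <- states p']
  else [:: ([::], [::], 0)].

Lemma statesS p Z :
  Z \in states p.+1 <->
  exists A q b, (A, q, b) \in states p /\
    ((exists2 j, j \in slots q b & Z = (A, insert j p q, j)) \/
     (exists x q', q = x :: q' /\ Z = (rcons A (x, p), q', b.-1))).
Proof.
split=> [/flatten_mapP[[[A q] b] Xp]|[A [q [b [Xp H]]]]].
  rewrite mem_cat => /orP[/mapP[j jq ->]|].
    by exists A, q, b; split=> //; left; exists j.
  case: q Xp => // x q Xp; rewrite inE => /eqP ->.
  by exists A, (x :: q), b; split=> //; right; exists x, q.
apply/flatten_mapP; exists (A, q, b) => //=; rewrite mem_cat.
case: H => [[j jq ->]|[x [q' [-> ->]]]].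
  by apply/orP; left; apply/mapP; exists j.
by rewrite inE eqxx orbT.
Qed.

Lemma states_ind (P : nat -> seq (nat * nat) -> seq nat -> nat -> Prop) :
  P 0 [::] [::] 0 ->
  (forall p A q b j, (A, q, b) \in states p -> P p A q b ->
     j \in slots q b -> P p.+1 A (insert j p q) j) ->
  (forall p A x q b, (A, x :: q, b) \in states p -> P p A (x :: q) b ->
     P p.+1 (rcons A (x, p)) q b.-1) ->
  forall p A q b, (A, q, b) \in states p -> P p A q b.
Proof.
move=> P0 Ppush Ppop; elim=> [|p IHp] A q b; first by rewrite inE => /eqP[-> -> ->].
case/statesS=> A0 [q0 [b0 [Xp [[j jq [-> -> ->]]|[x [q' [eq0 [-> -> ->]]]]]]]].
  exact: Ppush (IHp _ _ _ Xp) jq.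
by rewrite eq0 in Xp; apply: Ppop (IHp _ _ _ Xp).
Qed.

(** * Insertion and the ascent of the queue *)

Lemma perm_insert j p q : perm_eq (insert j p q) (p :: q).
Proof.
by rewrite -[in X in perm_eq _ X](cat_take_drop j q) perm_catC /= perm_cons perm_catC.
Qed.

Lemma size_insert j p q : size (insert j p q) = (size q).+1.
Proof. exact: perm_size (perm_insert j p q). Qed.

Lemma nth_insert j p q i : j <= size q ->
  nth 0 (insert j p q) i =
  if i < j then nth 0 q i else if i == j then p else nth 0 q i.-1.
Proof.
move=> lejq; rewrite nth_cat size_takel //; case: ltnP => ij; first by rewrite nth_take.
case: eqP => [->|/eqP ne]; first by rewrite subnn.
have -> : i - j = (i - j).-1.+1 by lia.
by rewrite /= nth_drop; congr nth; lia.
Qed.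

(* [b = 0] encodes the absence of an ascent. *)
Definition ascent_at (q : seq nat) (b : nat) :=
  (b < size q \/ b = 0) /\
  forall i, i.+1 < size q ->
    if i.+1 == b then nth 0 q i < nth 0 q i.+1 else nth 0 q i.+1 < nth 0 q i.

(** For [b < c], the entry at [c] would end an ascent according to [c] and a descent according to
    [b]. So the mark is a function of the queue. *)
Lemma ascent_at_inj q b c : ascent_at q b -> ascent_at q c -> b = c.
Proof.
wlog ltbc : b c / b < c => [H|] qb qc.
  by case: (ltngtP b c) => // h; [apply: H | symmetry; apply: H].
case: qb qc => _ /(_ c.-1) Hb [hc /(_ c.-1) Hc].
have {}hc : c.-1.+1 < size q by lia.
move: (Hb hc) (Hc hc); have -> : c.-1.+1 = c by lia.
by rewrite eqxx (_ : (c == b) = false); lia.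
Qed.

Lemma slots_le q b j : ascent_at q b -> j \in slots q b -> j <= size q.
Proof.
by case=> bq _; rewrite /slots; case: eqP => [_|b0]; rewrite ?mem_iota ?inE; lia.
Qed.

Lemma slotsP q b j i : ascent_at q b -> j \in slots q b -> i.+1 < size q ->
  i.+1 != j -> nth 0 q i.+1 < nth 0 q i.
Proof.
case=> bq H; rewrite /slots => hj iq ij; move: (H i iq); case: eqP => // ib.
by move: hj; case: eqP => [|_]; rewrite ?inE; lia.
Qed.

(** The queue can ascend only at an admissible slot, so cutting there leaves decreasing pieces. *)
Lemma slots_decr q b j : ascent_at q b -> j \in slots q b ->
  sorted gtn (take j q) /\ sorted gtn (drop j q).
Proof.
move=> qb hj; have jq := slots_le qb hj.
split; apply/(sortedP 0) => i; rewrite ?size_takel ?size_drop // => hi.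
  by rewrite /= (nth_take _ hi) (nth_take _ (ltnW hi)); apply: (slotsP qb hj); lia.
by rewrite /= !nth_drop addnS; apply: (slotsP qb hj); lia.
Qed.

(** The step into [p] ascends and the step out of it descends; an old ascent could only be at [j],
    where [p] now separates its two entries. *)
Lemma ascent_insert q b j p : ascent_at q b -> j \in slots q b ->
  all (gtn p) q -> ascent_at (insert j p q) j.
Proof.
move=> qb hj /(all_nthP 0) ltqp; have jq := slots_le qb hj.
split=> [|i]; rewrite size_insert; first by left.
move=> iq; rewrite !nth_insert //.
case: (ltngtP i.+1 j) => ij.
- by apply: (slotsP qb hj); lia.
- case: (eqVneq i j) => [->|ne]; first by apply: ltqp; lia.
  have := @slotsP q b j i.-1 qb hj; rewrite prednK; last by lia.
  by apply; lia.
- by apply: ltqp; lia.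
Qed.

(** * Invariants of reachable states *)

Lemma states_perm p A q b : (A, q, b) \in states p ->
  perm_eq (unzip1 A ++ unzip2 A ++ q) (iota 0 p).
Proof.
elim/states_ind: p A q b / => // p A.
  move=> q b j _ /seq.permP IH _; apply/seq.permP => a.
  rewrite -[p.+1]addn1 iotaD !count_cat -IH !count_cat.
  by have := count_cat a (take j q) (drop j q); rewrite cat_take_drop add0n /=; lia.
move=> x q b _ /seq.permP IH; apply/seq.permP => a.
rewrite -[p.+1]addn1 iotaD !count_cat -IH /unzip1 /unzip2 !map_rcons -!cats1.
by rewrite !count_cat add0n /=; lia.
Qed.

Lemma states_lt p A q b : (A, q, b) \in states p ->
  all (fun i => i < p) (unzip1 A ++ unzip2 A ++ q).
Proof.
move/states_perm/perm_mem => E; apply/allP => i.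
by rewrite E mem_iota.
Qed.

Lemma states_queue_lt p A q b : (A, q, b) \in states p -> all (gtn p) q.
Proof. by move/states_lt; rewrite !all_cat => /and3P[]. Qed.

Lemma states_ascent p A q b : (A, q, b) \in states p -> ascent_at q b.
Proof.
elim/states_ind: p A q b / => [|p A q b j Xp IH jq|p A x q b _ [xqb H]].
- by split; [right|].
- by apply: ascent_insert IH jq (states_queue_lt Xp).
- split=> [|i iq]; first by move: xqb => /=; lia.
  by move: (H i.+1 iq) => /=; case: b {xqb H}.
Qed.

Lemma states_nil p A b : (A, [::], b) \in states p -> b = 0.
Proof. by case/states_ascent => -[]. Qed.

(** * Distinctness of the states *)

Lemma filter_insert j p q : all (gtn p) q ->
  [seq x <- insert j p q | x != p] = q.
Proof.
move=> qp; rewrite filter_cat /= eqxx -filter_cat cat_take_drop.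
by apply/all_filterP/sub_all/qp => x /=; lia.
Qed.

Lemma mem_insert j p q : p \in insert j p q.
Proof. by rewrite mem_cat inE eqxx orbT. Qed.

Lemma uniq_flatten_map (S T : eqType) (f : S -> seq T) (s : seq S) :
  uniq s -> {in s, forall x, uniq (f x)} ->
  {in s &, forall x y z, z \in f x -> z \in f y -> x = y} ->
  uniq (flatten (map f s)).
Proof.
elim: s => //= x s IH /andP[xs us] uf inj; rewrite cat_uniq uf ?mem_head //=.
rewrite IH // => [|y ys|y z ys zs]; last 2 first.
- by apply: uf; rewrite inE ys orbT.
- by apply: inj; rewrite inE ?ys ?zs orbT.
rewrite andbT; apply/hasPn => z /flatten_mapP[y ys zy]; apply/negP => zx.
by move: xs; rewrite (inj x y _ _ z) ?ys ?inE ?eqxx ?ys ?orbT.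
Qed.

(** A state has one predecessor and arises from it in one way. Whether [p] is in the queue tells
    insertion from removal; the former queue is recovered by deleting [p] or by putting back the
    opener of the last arc, and the mark follows from the queue. *)
Lemma uniq_states p : uniq (states p).
Proof.
elim: p => // p IHp; apply: uniq_flatten_map => // [[[A q] b] Xp|].
  have ltq := states_queue_lt Xp.
  rewrite cat_uniq map_inj_uniq => [|i j [] //]; apply/and3P; split.
  - by rewrite /slots; case: eqP => // _; apply: iota_uniq.
  (* Only a removal lengthens the list of closed arcs. *)
  - case: q Xp ltq => // x q _ _; rewrite has_seq1.
    by apply/mapP => -[j _ [/(congr1 size)]]; rewrite size_rcons; lia.
  - by case: q {Xp ltq}.
move=> [[A q] b] [[A' q'] b'] X X' Z.
have [qp qp'] := (states_queue_lt X, states_queue_lt X').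
have eqb (E : q = q') : b = b'.
  by apply: (@ascent_at_inj q); [|rewrite E]; apply: states_ascent; eassumption.
(* A queue left by a removal does not contain [p]. *)
have noins j x (r r' : seq nat) : all (gtn p) (x :: r) -> r <> insert j p r'.
  case/andP=> _ /allP rp E; have /rp : p \in r by rewrite E mem_insert.
  by rewrite /= ltnn.
rewrite !mem_cat => /orP[/mapP[j _ ->] /orP[/mapP[k _ [-> E _]]|]|].
- have Eq : q = q' by rewrite -(filter_insert j qp) E filter_insert.
  by rewrite (eqb Eq) Eq.
- by case: q' qp' {X' eqb} => // x q' qp'; rewrite inE => /eqP[_ /esym/(noins _ _ _ _ qp')].
- case: q qp X eqb => // x q qp X eqb.
  rewrite inE => /eqP -> /orP[/mapP[k _ [_ /(noins _ _ _ _ qp)]]|] //.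
  case: q' qp' X' eqb => // x' q' qp' X' eqb; rewrite inE.
  by move=> /eqP[/rcons_inj[-> xx'] qq' _]; rewrite eqb xx' qq'.
Qed.

(** * Reachable states avoid both patterns *)

Implicit Types (x y z w : nat * nat) (L : seq (nat * nat)).

(** In both patterns the arcs are ordered by opener and [x], [y] cross; the patterns differ only in
    whether [z] closes after both or before both. *)
Definition occ321 (x y z : nat * nat) :=
  [&& x.1 < y.1, y.1 < z.1, z.1 < x.2, x.2 < y.2 & y.2 < z.2].

Definition occ213 (x y z : nat * nat) :=
  [&& x.1 < y.1, y.1 < z.1, z.1 < z.2, z.2 < x.2 & x.2 < y.2].

Definition avoiding (L : seq (nat * nat)) :=
  forall x y z, x \in L -> y \in L -> z \in L -> ~~ (occ321 x y z || occ213 x y z).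

Lemma mem_zip (s t : seq nat) x : x \in zip s t -> x.1 \in s /\ x.2 \in t.
Proof.
elim: s t => [|a s IH] [|e t] //=; rewrite !inE => /orP[/eqP-> /=|/IH[-> ->]].
  by rewrite !eqxx.
by rewrite !orbT.
Qed.

(** Moving along the lists lowers the opener and raises the closer. This excludes the crossing pair
    [x], [y] of either pattern. *)
Lemma zip_decr_incr (s t : seq nat) x y : sorted gtn s -> sorted ltn t ->
  x \in zip s t -> y \in zip s t -> x.1 < y.1 -> x.2 < y.2 -> False.
Proof.
elim: s t => [|a s IH] [|e t] //=; rewrite !path_sortedE; last 2 first.
- exact: ltn_trans.
- by move=> u v w /= vu wv; apply: ltn_trans wv vu.
move=> /andP[/allP sa ss] /andP[/allP te st]; rewrite !inE.
have mz w : w \in zip s t -> w.1 < a /\ e < w.2.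
  by case/mem_zip=> /sa + /te.
move=> /orP[/eqP->|xz] /orP[/eqP->|yz] /=; [lia|..|exact: IH xz yz].
by move/mz: yz; lia.
by move/mz: xz; lia.
Qed.

(* Pending arcs are closed in queue order, so any increasing choice [C] of future
   closers shows the patterns which the final matching will contain. *)
Lemma states_avoiding p A q b C : (A, q, b) \in states p ->
  sorted ltn C -> all (leq p) C -> size C = size q -> avoiding (A ++ zip q C).
Proof.
move=> Xp; elim/states_ind: p A q b / Xp C
  => [|p A q b j Xp IH jq|p A x q b Xp IH] C sC pC szC.
- by case: C {sC pC} szC.
- have := states_lt Xp; rewrite !all_cat => /and3P[/allP A1 /allP A2 /allP qp].
  have qb := states_ascent Xp; have leq_jq := slots_le qb jq.
  have [decl decr] := slots_decr qb jq.
  rewrite size_insert in szC.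
  (* [c] is the closer assigned to the new opener; without it, [C1 ++ C2] serves the queue before
     the insertion. *)
  have [C1 [c [C2 [szC1 eqC]]]] : exists C1 c C2, size C1 = j /\ C = C1 ++ c :: C2.
    have jC : j < size C by rewrite szC.
    exists (take j C), (nth 0 C j), (drop j.+1 C).
    by rewrite (size_takel (ltnW jC)) -drop_nth // cat_take_drop.
  have szjq : size (take j q) = size C1 by rewrite size_takel.
  have sC12 : sorted ltn (C1 ++ C2).
    apply: subseq_sorted ltn_trans _ _ _ sC.
    by rewrite eqC cat_subseq // subseq_cons.
  have {}IH : avoiding (A ++ zip (take j q) C1 ++ zip (drop j q) C2).
    rewrite -zip_cat // cat_take_drop; apply: IH => //.
      move: pC; rewrite eqC !all_cat /= => /and3P[p1 _ p2].
      by apply/andP; split; [move: p1|move: p2]; apply: sub_all => i; apply: ltnW.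
    by move: szC; rewrite eqC !size_cat /=; lia.
  move: sC pC; rewrite eqC all_cat sorted_pairwise; last exact: ltn_trans.
  rewrite pairwise_cat allrel_consr /= => /and3P[/andP[/allP C1c _] _].
  have lttr := ltn_trans; rewrite -(sorted_pairwise lttr) => /andP[/allP cC2 sC2].
  case/and3P=> /allP pC1 pc /allP pC2.
  have sC1 := subseq_sorted ltn_trans (prefix_subseq C1 C2) sC12.
  rewrite /insert zip_cat //= => x y z.
  have mA w : w \in A -> w.1 < p /\ w.2 < p.
    by move=> wA; rewrite A1 ?A2 //; apply: map_f.
  have m1 w : w \in zip (take j q) C1 -> [/\ w.1 < p, p < w.2 & w.2 < c].
    by case/mem_zip=> /mem_take/qp + w2; rewrite C1c // => ->; split=> //; apply: pC1.
  have m2 w : w \in zip (drop j q) C2 -> [/\ w.1 < p, p < w.2 & c < w.2].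
    by case/mem_zip=> /mem_drop/qp + w2 => ->; split=> //; [apply: pC2|apply: cC2].
  pose old := A ++ zip (take j q) C1 ++ zip (drop j q) C2.
  have memE w : w \in A ++ zip (take j q) C1 ++ (p, c) :: zip (drop j q) C2 ->
      w = (p, c) \/ w \in old.
    rewrite !mem_cat inE => /or4P[->|->|/eqP->|->]; rewrite ?orbT; by [right|left].
  have old_lt w : w \in old -> w.1 < p.
    by rewrite !mem_cat => /or3P[/mA[]|/m1[]|/m2[]].
  move=> /memE xE /memE yE /memE zE; apply/negP => H.
  (* All other openers are below [p], so the new arc can only play the role of [z]. *)
  have zp : z.1 <= p by case: zE => [->|/old_lt/ltnW].
  have {}xE : x \in old.
    by case: xE => // ex; move: H; rewrite ex /occ321 /occ213 /=; lia.
  have {}yE : y \in old.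
    by case: yE => // ex; move: H; rewrite ex /occ321 /occ213 /=; lia.
  case: zE => [ez|zold]; last by move: (IH x y z xE yE zold); rewrite H.
  have xy1 : x.1 < y.1 by move: H; rewrite /occ321 /occ213; lia.
  have xy2 : x.2 < y.2 by move: H; rewrite /occ321 /occ213; lia.
  move: H; rewrite ez /occ321 /occ213 /= => H.
  (* With [z = (p, c)], both [x] and [y] close after [p], so they are pending, and they lie on the
     same side of [c], inside one decreasing piece of the queue. *)
  move: xE; rewrite !mem_cat => /or3P[/mA[]|xE|xE]; first by lia.
    move: yE; rewrite !mem_cat => /or3P[/mA[]|yE|/m2[]]; [lia| |].
      exact: zip_decr_incr decl sC1 xE yE xy1 xy2.
    by case: (m1 _ xE); lia.
  move: yE; rewrite !mem_cat => /or3P[/mA[]|/m1[]|yE]; [lia| |].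
    by case: (m2 _ xE); lia.
  exact: zip_decr_incr decr sC2 xE yE xy1 xy2.
(* Before the removal, [p] was the future closer of the head. *)
- rewrite cat_rcons; apply: (IH (p :: C)) => /=; last by rewrite szC.
    rewrite path_sortedE ?sC ?andbT //; exact: ltn_trans.
  by rewrite leqnn; apply: sub_all pC => i; apply: ltnW.
Qed.

Lemma states_arcs p A q b : (A, q, b) \in states p ->
  sorted ltn (unzip2 A) /\ all (fun x => x.1 < x.2) A.
Proof.
move=> Xp; elim/states_ind: p A q b / Xp => // p A x q b Xp [srt /allP lts].
have := states_lt Xp; rewrite !all_cat /= => /and4P[_ /allP A2 xp _].
split; last by rewrite all_rcons /= xp; apply/allP.
rewrite /unzip2 map_rcons; move: srt; rewrite !(sorted_pairwise ltn_trans).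
by rewrite pairwise_rcons => ->; rewrite andbT; apply/allP.
Qed.

(** * Every avoiding matching is reached by the scan *)

Definition closed_arcs p L := [seq x <- L | x.2 < p].

(** For [L] sorted by closers, the openers come out in closing order, as in the queue. The bound
    [p <= x.2] is weak because the point [p] is not yet scanned. *)
Definition pending p L := [seq x.1 | x <- L & x.1 < p <= x.2].

(** Converse of [slots_decr]: an ascent away from the junction would lie inside a decreasing
    piece. *)
Lemma slots_cat q r b : ascent_at (q ++ r) b ->
  sorted gtn q -> sorted gtn r -> size q \in slots (q ++ r) b.
Proof.
move=> [hb H] /(sortedP 0) sq /(sortedP 0) sr; rewrite /slots.
case: eqP => [_|b0]; first by rewrite mem_iota size_cat; lia.
rewrite inE; apply/eqP; have {}hb : b.-1.+1 < size (q ++ r) by lia.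
have eb : b.-1.+1 = b by lia.
move: (H _ hb); rewrite eb eqxx !nth_cat.
rewrite size_cat eb in hb.
case: (ltngtP b (size q)) => // ltb.
  have -> : b.-1 < size q by lia.
  by have := sq b.-1; rewrite eb => /(_ ltb) /=; lia.
have -> : (b.-1 < size q) = false by lia.
have := sr (b - size q).-1; rewrite prednK ?subn_gt0 // => /(_ _) /=.
by rewrite -!subn1 subnAC => /(_ ltac:(lia)); lia.
Qed.

Lemma sorted_fst_gt L : sorted ltn (unzip2 L) ->
  (forall x y, x \in L -> y \in L -> x.2 < y.2 -> y.1 < x.1) ->
  sorted gtn (unzip1 L).
Proof.
rewrite /unzip1 /unzip2 !sorted_map => sL H.
by apply: (sub_in_sorted (P := mem L)) sL => [x y|]; [exact: H|exact/allP].
Qed.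

Lemma uniq_ends L1 x L2 w : uniq (unzip1 (L1 ++ x :: L2) ++ unzip2 (L1 ++ x :: L2)) ->
  w \in L1 ++ L2 -> [/\ w.1 != x.1, w.1 != x.2, w.2 != x.1 & w.2 != x.2].
Proof.
rewrite (@perm_uniq _ _ (x.1 :: x.2 :: unzip1 (L1 ++ L2) ++ unzip2 (L1 ++ L2))).
  move=> /= /and3P[+ + _] wL; rewrite !inE !mem_cat !negb_or.
  move=> /and3P[_ n1 n2] /andP[n3 n4].
  have [w1 w2] := (map_f fst wL, map_f snd wL).
  by split; [apply: contraNneq n1|apply: contraNneq n3
            |apply: contraNneq n2|apply: contraNneq n4] => <-.
apply/seq.permP => a; rewrite /unzip1 /unzip2 !map_cat /= !count_cat /=; lia.
Qed.

Lemma uniq_ends_in L x y : uniq (unzip1 L ++ unzip2 L) -> x \in L -> y \in L ->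
  y != x -> [/\ y.1 != x.1, y.1 != x.2, y.2 != x.1 & y.2 != x.2].
Proof.
move=> + xL; case/splitPr: xL => L1 L2 uL.
rewrite mem_cat inE => yL yx; apply: (uniq_ends uL).
by move: yL; rewrite (negbTE yx) mem_cat.
Qed.

Lemma sorted_split L1 x L2 w : sorted ltn (unzip2 (L1 ++ x :: L2)) ->
  (w \in L1 -> w.2 < x.2) /\ (w \in L2 -> x.2 < w.2).
Proof.
rewrite sorted_map sorted_pairwise; last by move=> ? ? ?; apply: ltn_trans.
rewrite pairwise_cat allrel_consr /= => /and3P[/andP[/allP h1 _] _ /andP[/allP h2 _]].
by split=> [/h1|/h2].
Qed.

Lemma eq_filter_in (P Q : pred (nat * nat)) L :
  (forall x, x \in L -> P x = Q x) -> filter P L = filter Q L.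
Proof. by move=> PQ; apply: eq_in_filter. Qed.

Lemma filter_nil_in (P : pred (nat * nat)) L :
  (forall x, x \in L -> ~~ P x) -> filter P L = [::].
Proof.
elim: L => //= x L IH H; rewrite (negbTE (H x _)) ?mem_head // IH // => y yL.
by apply: H; rewrite inE yL orbT.
Qed.

Lemma mem_unzip i L : i \in unzip1 L ++ unzip2 L ->
  exists2 x : nat * nat, x \in L & i = x.1 \/ i = x.2.
Proof. by rewrite mem_cat => /orP[]/mapP[x xL E]; exists x; auto. Qed.

(** The scan of [L] never gets stuck. An opener lands between the pending arcs closing before its
    own arc and those closing after it, and avoidance makes this slot admissible; a closer belongs
    to the head of the queue. *)
Lemma states_complete N L : sorted ltn (unzip2 L) ->
  all (fun x => x.1 < x.2) L -> perm_eq (unzip1 L ++ unzip2 L) (iota 0 N) ->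
  avoiding L ->
  forall p, p <= N -> exists b, (closed_arcs p L, pending p L, b) \in states p.
Proof.
move=> sL /allP ltL pL avL; elim=> [_|p IHp pN].
  exists 0; have -> : closed_arcs 0 L = [::] by rewrite /closed_arcs; elim: (L).
  by have -> : pending 0 L = [::] by rewrite /pending; elim: (L).
have [b Xp] := IHp (ltnW pN).
have uL : uniq (unzip1 L ++ unzip2 L) by rewrite (perm_uniq pL) iota_uniq.
have /mem_unzip[x xL [px|px]] : p \in unzip1 L ++ unzip2 L
  by rewrite (perm_mem pL) mem_iota.
  have [L1 [L2 eL]] : exists L1 L2, L = L1 ++ x :: L2.
    by case/splitPr: xL => L1 L2; exists L1, L2.
  have ltx : x.1 < x.2 by apply: ltL.
  have ne w : w \in L1 ++ L2 -> w.1 != p /\ w.2 != p.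
    by rewrite eL in uL => /(uniq_ends uL); rewrite -px => -[].
  have ne1 w : w \in L1 -> w.1 != p /\ w.2 != p by move=> wL; apply: ne; rewrite mem_cat wL.
  have ne2 w : w \in L2 -> w.1 != p /\ w.2 != p
    by move=> wL; apply: ne; rewrite mem_cat wL orbT.
  have eqc : closed_arcs p.+1 L = closed_arcs p L.
    by apply: eq_filter_in => w /=; rewrite eL mem_cat inE => /or3P[/ne1|/eqP->|/ne2]; lia.
  have eqf (L' : seq (nat * nat)) : {in L', forall w, w.1 != p /\ w.2 != p} ->
      [seq w <- L' | w.1 < p.+1 <= w.2] = [seq w <- L' | w.1 < p <= w.2].
    by move=> H; apply: eq_filter_in => w /= /H; lia.
  have eqp : pending p L = pending p L1 ++ pending p L2.
    by rewrite /pending eL filter_cat map_cat /= -px ltnn.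
  have eqp' : pending p.+1 L = insert (size (pending p L1)) p (pending p L).
    rewrite eqp /insert take_size_cat // drop_size_cat // /pending eL filter_cat map_cat /=.
    by rewrite !eqf // -px ltnSn [p < x.2](_ : _ = true) // px.
  (* The slot is the number of pending arcs that close before [x]. *)
  exists (size (pending p L1)); apply/statesS; exists (closed_arcs p L), (pending p L), b.
  split=> //; left; exists (size (pending p L1)); rewrite ?eqc ?eqp' //.
  have := states_ascent Xp; rewrite eqp => /slots_cat; apply.
    apply: sorted_fst_gt => [|y z].
      apply: subseq_sorted ltn_trans _ _ _ sL; rewrite eL map_subseq //.
      exact: subseq_trans (filter_subseq _ _) (prefix_subseq _ _).
    rewrite !mem_filter => /andP[Hy yL1] /andP[Hz zL1] yz2.
    have [yL zL] : y \in L /\ z \in L by rewrite eL !mem_cat yL1 zL1.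
    have zy : z != y by apply: contraTneq yz2 => ->; rewrite ltnn.
    have [zy1 _ _ _] := uniq_ends_in uL yL zL zy.
    have zx2 : z.2 < x.2 by rewrite eL in sL; apply: (sorted_split z sL).1.
    have [_ yp] := ne1 y yL1.
    (* Were the openers increasing, [y], [z], [x] would form 321, as [x] closes last. *)
    by have := avL y z x yL zL xL; rewrite /occ321 /occ213; lia.
  apply: sorted_fst_gt => [|y z].
    apply: subseq_sorted ltn_trans _ _ _ sL; rewrite eL map_subseq //.
    apply: subseq_trans (filter_subseq _ _) _.
    exact: subseq_trans (subseq_cons _ _) (suffix_subseq _ _).
  rewrite !mem_filter => /andP[Hy yL2] /andP[Hz zL2] yz2.
  have [yL zL] : y \in L /\ z \in L by rewrite eL !mem_cat !inE yL2 zL2 !orbT.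
  have zy : z != y by apply: contraTneq yz2 => ->; rewrite ltnn.
  have [zy1 _ _ _] := uniq_ends_in uL yL zL zy.
  have xy2 : x.2 < y.2 by rewrite eL in sL; apply: (sorted_split y sL).2.
  (* Here [x] closes first, so increasing openers would give 213. *)
  by have := avL y z x yL zL xL; rewrite /occ321 /occ213; lia.
have [L1 [L2 eL]] : exists L1 L2, L = L1 ++ x :: L2.
  by case/splitPr: xL => L1 L2; exists L1, L2.
have ltx : x.1 < x.2 by apply: ltL.
have m1 w : w \in L1 -> w.2 < p.
  by rewrite px; rewrite eL in sL; apply: (sorted_split w sL).1.
have m2 w : w \in L2 -> p < w.2 /\ w.1 != p.
  move=> wL; split; first by rewrite px; rewrite eL in sL; apply: (sorted_split w sL).2.
  rewrite eL in uL; have [|_ + _ _] := @uniq_ends _ _ _ w uL; last by rewrite px.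
  by rewrite mem_cat wL orbT.
(* Arcs listed before [x] close before [p], so none is pending and [x.1] heads the queue. *)
have nil1 : [seq w <- L1 | w.1 < p <= w.2] = [::].
  by apply: filter_nil_in => w /= /m1; lia.
have nil1' : [seq w <- L1 | w.1 < p.+1 <= w.2] = [::].
  by apply: filter_nil_in => w /= /m1; lia.
have nil2 (P : pred (nat * nat)) :
    (forall w, P w -> w.2 <= p) -> [seq w <- L2 | P w] = [::].
  by move=> HP; apply: filter_nil_in => w /= /m2[+ _]; apply: contraTN => /HP; lia.
exists b.-1; apply/statesS; exists (closed_arcs p L), (pending p L), b; split=> //; right.
exists x.1, (pending p.+1 L); split.
  rewrite /pending eL !filter_cat nil1 nil1' /= -px ltnn andbF px ltx leqnn /= -px.
  by congr (_ :: map _ _); apply: eq_filter_in => w /= /m2; lia.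
congr (_, _, _); rewrite /closed_arcs eL !filter_cat /= -px ltnn ltnSn.
rewrite !nil2 ?cats0 => [|w|w]; [|lia..].
rewrite cats1 px -surjective_pairing; congr rcons.
by rewrite -px; apply: eq_filter_in => w /= /m1; lia.
Qed.

(** * Matchings as lists of arcs *)

Definition arc_lists N := [seq X.1.1 | X <- states N & X.1.2 == [::]].

(** Sorting by closers selects one list for each matching. *)
Definition matching_list N L :=
  [&& sorted ltn (unzip2 L), all (fun x => x.1 < x.2) L
    & perm_eq (unzip1 L ++ unzip2 L) (iota 0 N)].

Lemma arc_listsP N L : L \in arc_lists N <-> matching_list N L /\ avoiding L.
Proof.
split=> [/mapP[[[A q] b]]|[/and3P[sL ltL pL] avL]].
  rewrite mem_filter /= => /andP[/eqP -> Xp ->].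
  have [sA ltA] := states_arcs Xp; split.
    by have := states_perm Xp; rewrite cats0 /matching_list sA ltA.
  by have := states_avoiding Xp (C := [::]); rewrite cats0; apply.
have [b Xp] := states_complete sL ltL pL avL (leqnn N).
have ltN i : i \in unzip1 L ++ unzip2 L -> i < N by rewrite (perm_mem pL) mem_iota.
have lt2 x : x \in L -> x.2 < N.
  by move=> xL; apply: ltN; rewrite mem_cat orbC map_f.
have eL : closed_arcs N L = L.
  by apply/all_filterP/allP => x /lt2.
have eq0 : pending N L = [::].
  by rewrite /pending filter_nil_in // => x /lt2; lia.
by rewrite eL eq0 in Xp; apply/mapP; exists (L, [::], b); rewrite ?mem_filter.
Qed.

(** An empty queue forces the mark 0, so the arcs alone determine the state. *)
Lemma uniq_arc_lists N : uniq (arc_lists N).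
Proof.
rewrite map_inj_in_uniq ?filter_uniq ?uniq_states //.
move=> [[A q] b] [[A' q'] b']; rewrite !mem_filter /=.
move=> /andP[/eqP-> X] /andP[/eqP-> X'] ->.
by rewrite (states_nil X) (states_nil X').
Qed.

(** * Matchings as sets of arcs, and their patterns *)

Section ArcSets.

Variable n : nat.
Local Notation arc := ('I_(2 * n) * 'I_(2 * n))%type.
Implicit Types (M : {set arc}) (a d : arc).

Definition nat_arc a : nat * nat := (val a.1, val a.2).

Lemma nat_arc_inj : injective nat_arc.
Proof. by move=> [a1 a2] [d1 d2] [/val_inj-> /val_inj->]. Qed.

Definition nat_arcs M := [seq nat_arc a | a <- enum M].

Definition arc_set L : {set arc} := [set a | nat_arc a \in L].

Lemma mem_nat_arcs M a : (nat_arc a \in nat_arcs M) = (a \in M).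
Proof. by rewrite mem_map ?mem_enum //; apply: nat_arc_inj. Qed.

Lemma nat_arcsP M x : x \in nat_arcs M -> exists2 a, a \in M & x = nat_arc a.
Proof. by case/mapP=> a; rewrite mem_enum; exists a. Qed.

Lemma uniq_nat_arcs M : uniq (nat_arcs M).
Proof. by rewrite map_inj_uniq ?enum_uniq //; apply: nat_arc_inj. Qed.

Lemma unzip_lt N L x : perm_eq (unzip1 L ++ unzip2 L) (iota 0 N) -> x \in L ->
  x.1 < N /\ x.2 < N.
Proof.
move=> pL xL; have ltN i : i \in unzip1 L ++ unzip2 L -> i < N.
  by rewrite (perm_mem pL) mem_iota.
by split; apply: ltN; rewrite mem_cat map_f ?orbT.
Qed.

Lemma arc_setK L : perm_eq (unzip1 L ++ unzip2 L) (iota 0 (2 * n)) ->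
  perm_eq (nat_arcs (arc_set L)) L.
Proof.
move=> pL; apply: uniq_perm; first exact: uniq_nat_arcs.
  apply: (@map_uniq _ _ fst); have := iota_uniq 0 (2 * n).
  by rewrite -(perm_uniq pL) cat_uniq => /and3P[].
move=> [i j]; apply/idP/idP => [/nat_arcsP[a + ->]|ijL]; first by rewrite inE.
have [/= lti ltj] := unzip_lt pL ijL.
by rewrite -[(i, j)]/(nat_arc (Ordinal lti, Ordinal ltj)) mem_nat_arcs inE.
Qed.

Lemma perfect_matchingP M :
  perfect_matching M <->
  all (fun x => x.1 < x.2) (nat_arcs M) /\
  perm_eq (unzip1 (nat_arcs M) ++ unzip2 (nat_arcs M)) (iota 0 (2 * n)).
Proof.
set s := _ ++ _.
have szs : size s = 2 * #|M| by rewrite size_cat !size_map -cardE addnn -mul2n.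
have ltsM : all (fun x => x.1 < x.2) (nat_arcs M) = [forall p in M, (p.1 < p.2)%N].
  apply/allP/forall_inP => [H a aM|H x /nat_arcsP[a aM ->]]; last exact: H.
  by apply: (H (nat_arc a)); rewrite mem_nat_arcs.
have mems i : reflect (exists2 a, a \in M & i = val a.1 \/ i = val a.2) (i \in s).
  apply: (iffP idP) => [/mem_unzip[x /nat_arcsP[a aM ->] E]|[a aM E]]; first by exists a.
  have aM' : nat_arc a \in nat_arcs M by rewrite mem_nat_arcs.
  by rewrite mem_cat; apply/orP; case: E => ->; [left|right];
    apply/mapP; exists (nat_arc a).
rewrite /perfect_matching -ltsM; split=> [/and4P[/eqP szM -> _ /eqP cov]|[-> ps]].
  split=> //; have sub : {subset iota 0 (2 * n) <= s}.
    move=> i; rewrite mem_iota => /= lti; apply/mems.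
    have : Ordinal lti \in \bigcup_(p in M) ends p by rewrite cov inE.
    case/bigcupP=> a aM; rewrite /ends !inE => E; exists a => //.
    by move: E => /orP[]/eqP <-; [left|right].
  (* The list [s] has length [2n] and covers [2n] points, so no point is repeated. *)
  have les : size s <= size (iota 0 (2 * n)) by rewrite szs szM size_iota.
  have us := leq_size_uniq (iota_uniq 0 _) sub les.
  have [_ E] := uniq_min_size (iota_uniq 0 _) sub les.
  by apply: uniq_perm; rewrite ?iota_uniq // => i; rewrite E.
apply/and4P; split=> //.
- by have := perm_size ps; rewrite szs size_iota => /eqP; rewrite eqn_mul2l.
- apply/forall_inP => a aM; apply/forall_inP => d dM; apply/implyP => ad.
  have us : uniq s by rewrite (perm_uniq ps) iota_uniq.
  have [] := uniq_ends_in us (x := nat_arc a) (y := nat_arc d).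
  + by rewrite mem_nat_arcs.
  + by rewrite mem_nat_arcs.
  + by rewrite (inj_eq nat_arc_inj) eq_sym.
  move=> n1 n2 n3 n4; rewrite disjoints_subset; apply/subsetP => e.
  rewrite /ends !inE negb_or => /orP[]/eqP->; rewrite -!val_eqE.
    by rewrite eq_sym n1 eq_sym n3.
  by rewrite eq_sym n2 eq_sym n4.
- apply/eqP/setP => i; rewrite inE; apply/bigcupP.
  have /mems[a aM E] : val i \in s by rewrite (perm_mem ps) mem_iota /= ltn_ord.
  by exists a => //; rewrite /ends !inE -!val_eqE; case: E => ->; rewrite eqxx ?orbT.
Qed.

Lemma containsP k (tau : 'S_k) M :
  reflect (exists i : 'I_(k + k) -> 'I_(2 * n),
             (forall u v : 'I_(k + k), u < v -> i u < i v) /\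
             (forall u : 'I_k, (i (lshift k u), i (rev_ord (lshift k (tau u)))) \in M))
    (contains tau M).
Proof.
apply: (iffP existsP) => [[i /andP[/forallP mono /forallP H]]|[i [mono H]]].
  by exists i; split=> // u v uv; have /forallP/(_ v)/implyP := mono u; apply.
exists (finfun i); apply/andP; split; apply/forallP => u; last by rewrite !ffunE.
by apply/forallP => v; apply/implyP => uv; rewrite !ffunE; apply: mono.
Qed.

(** Lists the embedding as six points; [5 - tau u] is the value of [rev_ord] there. The default [e]
    is quantified because ['I_(2 * n)] may be empty. *)
Lemma contains3P (tau : 'S_3) M :
  contains tau M <->
  exists s : seq 'I_(2 * n),
    [/\ size s = 6, sorted ltn (map val s)
       & forall (u : 'I_3) (e : 'I_(2 * n)), (nth e s u, nth e s (5 - tau u)) \in M].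
Proof.
split=> [/containsP[i [mono H]]|[s [sz6 srt H]]].
  exists (codom i); rewrite size_codom card_ord; split=> // [|u e].
    rewrite 2!sorted_map; apply: (sub_sorted (e := relpre val ltn)) => [u v|].
      exact: mono.
    by move: (iota_ltn_sorted 0 (3 + 3)); rewrite -val_enum_ord sorted_map.
  have nthE (v : 'I_(3 + 3)) : nth e (codom i) v = i v.
    by rewrite (nth_map v) ?size_enum_ord // nth_ord_enum.
  by have := H u; rewrite -!nthE.
case: s sz6 srt H => [|e s] // sz6 srt H; apply/containsP.
exists (fun u => nth e (e :: s) u); split=> [u v uv|u]; last first.
  exact: H.
have := sorted_ltn_nth ltn_trans 0 srt; rewrite size_map sz6 => /(_ u v).
by rewrite !(nth_map e) ?sz6 // => ->; rewrite ?inE.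
Qed.

Lemma contains321 M :
  contains pat321 M <->
  exists a d e, [/\ a \in M, d \in M, e \in M & occ321 (nat_arc a) (nat_arc d) (nat_arc e)].
Proof.
split=> [/contains3P[s [sz srt H]]|[a [d [e [aM dM eM]]]]].
  case: s sz srt H => [|e0 [|e1 [|e2 [|e3 [|e4 [|e5 [|]]]]]]] //= _ srt H.
  (* For [u = 0, 1, 2] the index [5 - pat321 u] is 3, 4, 5. *)
  exists (e0, e3), (e1, e4), (e2, e5); rewrite /occ321 /=.
  have := H (@Ordinal 3 0 isT) e0; rewrite tpermL /= => ->.
  have := H (@Ordinal 3 1 isT) e0; rewrite tpermD //= => ->.
  by have := H (@Ordinal 3 2 isT) e0; rewrite tpermR /= => ->; split=> //; lia.
rewrite /occ321 => /and5P[h1 h2 h3 h4 h5]; apply/contains3P.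
exists [:: a.1; d.1; e.1; a.2; d.2; e.2]; split=> //= [|u v].
  by rewrite h1 h2 h3 h4 h5.
case: u => [[|[|[|//]]] lt_u].
- by rewrite (_ : Ordinal lt_u = @Ordinal 3 0 isT) ?tpermL -?surjective_pairing //;
  apply: val_inj.
- by rewrite (_ : Ordinal lt_u = @Ordinal 3 1 isT) ?tpermD -?surjective_pairing //;
  apply: val_inj.
- by rewrite (_ : Ordinal lt_u = @Ordinal 3 2 isT) ?tpermR -?surjective_pairing //;
  apply: val_inj.
Qed.

Lemma contains213 M :
  contains pat213 M <->
  exists a d e, [/\ a \in M, d \in M, e \in M & occ213 (nat_arc a) (nat_arc d) (nat_arc e)].
Proof.
split=> [/contains3P[s [sz srt H]]|[a [d [e [aM dM eM]]]]].
  case: s sz srt H => [|e0 [|e1 [|e2 [|e3 [|e4 [|e5 [|]]]]]]] //= _ srt H.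
  (* For [u = 0, 1, 2] the index [5 - pat213 u] is 4, 5, 3. *)
  exists (e0, e4), (e1, e5), (e2, e3); rewrite /occ213 /=.
  have := H (@Ordinal 3 0 isT) e0; rewrite tpermL /= => ->.
  have := H (@Ordinal 3 1 isT) e0; rewrite tpermR /= => ->.
  by have := H (@Ordinal 3 2 isT) e0; rewrite tpermD //= => ->; split=> //; lia.
rewrite /occ213 => /and5P[h1 h2 h3 h4 h5]; apply/contains3P.
exists [:: a.1; d.1; e.1; e.2; a.2; d.2]; split=> //= [|u v].
  by rewrite h1 h2 h3 h4 h5.
case: u => [[|[|[|//]]] lt_u].
- by rewrite (_ : Ordinal lt_u = @Ordinal 3 0 isT) ?tpermL -?surjective_pairing //;
  apply: val_inj.
- by rewrite (_ : Ordinal lt_u = @Ordinal 3 1 isT) ?tpermR -?surjective_pairing //;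
  apply: val_inj.
- by rewrite (_ : Ordinal lt_u = @Ordinal 3 2 isT) ?tpermD -?surjective_pairing //;
  apply: val_inj.
Qed.

Lemma avoidingP M :
  avoids pat213 M && avoids pat321 M <-> avoiding (nat_arcs M).
Proof.
rewrite /avoids; split=> [/andP[no213 no321] x y z|avM].
  move=> /nat_arcsP[a aM ->] /nat_arcsP[d dM ->] /nat_arcsP[e eM ->].
  apply/negP => /orP[occ|occ].
    by case/negP: no321; apply/contains321; exists a, d, e.
  by case/negP: no213; apply/contains213; exists a, d, e.
apply/andP; split; apply/negP.
  case/contains213=> a [d [e [aM dM eM occ]]].
  by have := avM (nat_arc a) (nat_arc d) (nat_arc e);
    rewrite !mem_nat_arcs occ orbT => /(_ aM dM eM).
case/contains321=> a [d [e [aM dM eM occ]]].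
by have := avM (nat_arc a) (nat_arc d) (nat_arc e);
    rewrite !mem_nat_arcs occ => /(_ aM dM eM).
Qed.

End ArcSets.

(** * Counting matchings by arc lists *)

Lemma eq_avoiding L L' : L =i L' -> avoiding L -> avoiding L'.
Proof. by move=> E avL x y z; rewrite -!E; apply: avL. Qed.

Lemma matching_list_inj N L L' : matching_list N L -> matching_list N L' ->
  L =i L' -> L = L'.
Proof.
case/and3P=> sL _ _ /and3P[sL' _ _].
apply: (@irr_sorted_eq _ (relpre snd ltn)); rewrite -?sorted_map //.
  by move=> x y z; apply: ltn_trans.
by move=> x /=; rewrite ltnn.
Qed.

(** [arc_set] is a bijection from arc lists onto matchings; closers being distinct, sorting the arcs
    by closer inverts it. *)
Lemma card_matchings n : #|matchings_213_321 n| = size (arc_lists (2 * n)).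
Proof.
rewrite -(size_map (@arc_set n)).
have inj : {in arc_lists (2 * n) &, injective (@arc_set n)}.
  move=> L L' /arc_listsP[mL _] /arc_listsP[mL' _] E.
  apply: (matching_list_inj mL mL') => x.
  case/and3P: mL mL' => _ _ pL /and3P[_ _ pL'].
  by rewrite -(perm_mem (arc_setK pL)) E (perm_mem (arc_setK pL')).
have u : uniq (map (@arc_set n) (arc_lists (2 * n))).
  by rewrite map_inj_in_uniq ?uniq_arc_lists.
rewrite -(card_uniqP u); apply: eq_card => M; rewrite inE.
apply/and3P/mapP => [[/perfect_matchingP[ltM pM] av213 av321]|[L]].
  exists (sort (relpre snd leq) (nat_arcs M)).
    apply/arc_listsP; have pS := permEl (perm_sort (relpre snd leq) (nat_arcs M)).
    split; last first.
      apply: (eq_avoiding (L := nat_arcs M)) => [x|]; first by rewrite (perm_mem pS).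
      by apply/avoidingP/andP.
    have p2 : perm_eq (unzip1 (sort (relpre snd leq) (nat_arcs M)) ++
                       unzip2 (sort (relpre snd leq) (nat_arcs M))) (iota 0 (2 * n)).
      by apply: perm_trans pM; apply: perm_cat; apply: perm_map.
    rewrite /matching_list p2 (perm_all _ pS) ltM !andbT ltn_sorted_uniq_leq.
    apply/andP; split.
      by move: (iota_uniq 0 (2 * n)); rewrite -(perm_uniq p2) cat_uniq => /and3P[].
    by rewrite sorted_map sort_sorted // => x y; apply: leq_total.
  by apply/setP => a; rewrite inE mem_sort mem_nat_arcs.
case/arc_listsP=> /and3P[sL ltL pL] avL ->; have pS := arc_setK pL.
have [] : avoids pat213 (arc_set n L) /\ avoids pat321 (arc_set n L).
  by apply/andP/avoidingP; apply: eq_avoiding avL => x; rewrite (perm_mem pS).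
split=> //; apply/perfect_matchingP; rewrite (perm_all _ pS); split=> //.
by apply: perm_trans pL; apply: perm_cat; apply: perm_map.
Qed.

(** Each closed arc uses two of the [p] scanned points, each pending opener one. *)
Lemma odd_states p A q b : (A, q, b) \in states p -> odd p = odd (size q).
Proof.
move/states_perm/perm_size; rewrite size_iota !size_cat !size_map => <-.
by rewrite addnA oddD addnn odd_double.
Qed.

(** * The functional equation *)

Local Open Scope ring_scope.

(** Generic in the semiring, so that [t] and [u] can be specialised. As [0 ^+ 0 = 1], setting
    [u = 0] keeps the states without ascent, and [t = u = 0] keeps among them those with an empty
    queue. *)
Definition weight (A : nzSemiRingType) (t u : A) (X : state) : A :=
  t ^+ size X.1.2 * u ^+ X.2.

(** Without ascent, a queue of length [a] yields [t^(a+1) (1 + u + ... + u^a)] by insertion: the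
    summand 1 gives the first term, the others the fourth; removal gives the third. With an ascent,
    insertion keeps the mark (first term) and removal lowers both exponents (second term). *)
Lemma weight_successors (F : fieldType) (t u : F) p (X : state) :
  t != 0 -> u != 0 -> 1 - u != 0 -> ascent_at X.1.2 X.2 ->
  \sum_(Y <- successors p X) weight t u Y =
    t * weight t u X + (weight t u X - weight t 0 X) / (t * u)
    + (weight t 0 X - weight 0 0 X) / t
    + t * u / (1 - u) * (weight t 0 X - weight (t * u) 0 X).
Proof.
case: X => [[A q] b] /= t0 u0 u1 [hb _]; rewrite /weight big_cat big_map /=.
rewrite /slots; case: b hb => [|b] hb /=.
  under eq_bigr do rewrite size_insert /=.
  rewrite -big_distrr /= !expr0 !mulr1.
  have -> : \sum_(j <- iota 0 (size q).+1) u ^+ j = (1 - u ^+ (size q).+1) / (1 - u).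
    apply: (canRL (mulfK u1)); rewrite -[iota _ _]/(index_iota 0 (size q).+1) big_mkord.
    by rewrite -[RHS]opprB subrX1 -mulNr opprB mulrC.
  case: q hb => [|x q] _ /=; rewrite ?big_nil ?big_seq1 /= ?expr0 ?expr1 ?mulr1.
    by field; rewrite t0 u0 u1.
  by rewrite !exprS exprMn mul0r; field; rewrite t0 u0 u1.
rewrite big_seq1 /= size_insert !exprS !mul0r !mulr0.
case: q hb => [|x q] /= hb; first by case: hb.
rewrite big_seq1 /= !exprS; field.
by rewrite t0 u0 u1.
Qed.

Section GeneratingPolynomials.

Variable R : idomainType.
Local Notation P := {mpoly R[2]}.
Local Notation K := {fraction {mpoly R[2]}}.

(** The coefficient of [z^p] in the solution [G]. *)
Definition state_poly p : P := \sum_(X <- states p) weight (varT R) (varU R) X.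

Lemma subst_state_poly (a b : P) p :
  subst_tu state_poly a b p = \sum_(X <- states p) weight (tofrac a : K) (tofrac b) X.
Proof.
rewrite /subst_tu /state_poly (rmorph_sum (comp_mpoly _)) rmorph_sum /=.
apply: eq_bigr => X _.
rewrite /weight (rmorphM (comp_mpoly _)) !(rmorphXn (comp_mpoly _)) /= !comp_mpolyXU.
by rewrite tofracM !tofracXn.
Qed.

Lemma subst_tu_id (G : nat -> P) m : subst_tu G (varT R) (varU R) m = tofrac (G m).
Proof.
rewrite /subst_tu; congr tofrac; rewrite -[RHS]comp_mpoly_id; congr (_ \mPo _).
apply/eq_from_tnth => i; rewrite tnth_mktuple (tnth_nth 0) /=.
by case: i => -[|[|//]] lti /=; congr 'X_ _; apply: val_inj.
Qed.

(** Used to see that the denominators [t], [u] and [1 - u] are nonzero, by evaluation at a point. *)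
Lemma meval_neq0 (v : 'I_2 -> R) (f : P) : f.@[v] != 0 -> f != 0.
Proof. by apply: contraNneq => ->; rewrite meval0. Qed.

Lemma tofrac_varT_neq0 : tofrac (varT R) != 0.
Proof. by rewrite tofrac_eq0 (@meval_neq0 (fun=> 1)) // mevalXU oner_eq0. Qed.

Lemma tofrac_varU_neq0 : tofrac (varU R) != 0.
Proof. by rewrite tofrac_eq0 (@meval_neq0 (fun=> 1)) // mevalXU oner_eq0. Qed.

Lemma sub1_tofrac_varU_neq0 : 1 - tofrac (varU R) != 0.
Proof.
rewrite -tofrac1 -tofracB tofrac_eq0 (@meval_neq0 (fun=> 0)) //.
by rewrite mevalB meval1 mevalXU subr0 oner_eq0.
Qed.

Lemma functional_equation_state_poly : functional_equation state_poly.
Proof.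
move=> m; rewrite /=; case: m => [|m] /=; rewrite !subst_state_poly.
  by rewrite big_seq1 /weight !expr0 mulr1 addr0.
rewrite add0r big_flatten big_map /= tofracM tofrac0.
(* The right-hand side is linear in the weights, so the equation is checked state by state. *)
rewrite -!sumrB !big_distrr !big_distrl -!big_split /=; rewrite !big_seq.
apply: eq_bigr => -[[A q] b] /states_ascent qb.
by apply: weight_successors;
  rewrite ?tofrac_varT_neq0 ?tofrac_varU_neq0 ?sub1_tofrac_varU_neq0.
Qed.

(** The constant coefficient is 1, and the equation expresses each later coefficient through the
    preceding one. *)
Lemma functional_equation_inj (G H : nat -> P) :
  functional_equation G -> functional_equation H -> H =1 G.
Proof.
move=> eqG eqH; elim=> [|m IHm].
  by apply/eqP; rewrite -tofrac_eq -!subst_tu_id eqG eqH.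
apply/eqP; rewrite -tofrac_eq -!subst_tu_id eqG eqH /=.
by rewrite /subst_tu IHm.
Qed.

Lemma size_arc_lists m :
  (size (arc_lists m))%:R = subst_tu state_poly 0 0 m.
Proof.
rewrite subst_state_poly size_map -sum1_size natr_sum big_filter big_mkcond /=.
rewrite !big_seq; apply: eq_bigr => -[[A q] b] Xm; rewrite /weight /= tofrac0.
case: q Xm => [|x q] Xm /=; last by rewrite exprS !mul0r.
by rewrite (states_nil Xm) !expr0 mulr1.
Qed.

End GeneratingPolynomials.

Theorem theorem6p6 (R : idomainType) (charR0 : [pchar R] =i pred0) :
  exists G : nat -> {mpoly R[2]},
    [/\ functional_equation G,
        forall H : nat -> {mpoly R[2]}, functional_equation H -> H =1 G
      & ps_even (fun n => (#|matchings_213_321 n|%:R : {fraction {mpoly R[2]}}))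
          =1 subst_tu G 0 0].
Proof.
exists (state_poly R); split; first exact: functional_equation_state_poly.
  move=> H; apply: functional_equation_inj; exact: functional_equation_state_poly.
move=> m; rewrite -size_arc_lists /ps_even; case: ifP => om.
  (* After an odd number of points the queue has odd length, so it is not empty. *)
  suff -> : arc_lists m = [::] by [].
  rewrite /arc_lists (eq_in_filter (a2 := pred0)) ?filter_pred0 // => -[[A q] b] Xm.
  by apply/eqP => /= q0; have := odd_states Xm; rewrite om q0.
by rewrite card_matchings mul2n -[in RHS](odd_double_half m) om.
Qed.
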